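(* For every integer $\ell\ge 3$ and every integer $k$ satisfying $\ell+1\le k\le 2\ell-2$, there is a constant $c_{k,\ell}>0$ (depending only on $k$ and $\ell$) such that, for every sufficiently large integer $n$, there is a $k$-uniform relaxed $\ell$-tree $\mathcal{T}$ on exactly $n$ vertices with $$\widehat{R}_k(\mathcal{T})\ge 2^{c_{k,\ell}\,n^{1/\ell}}.$$
   Context: A $k$-uniform hypergraph ($k$-graph) $\mathcal{G}$ on a finite vertex set $V(\mathcal{G})$ is a family $E(\mathcal{G})$ of $k$-element subsets (called edges) of $V(\mathcal{G})$. For $k$-graphs $\mathcal{G}$ and $\mathcal{H}$, write $\mathcal{H}\longrightarrow_k\mathcal{G}$ if every red-blue coloring of the edges of $\mathcal{H}$ contains a monochromatic copy of $\mathcal{G}$ (a copy being a not necessarily induced subhypergraph of $\mathcal{H}$ isomorphic to $\mathcal{G}$, all of whose edges have the same color). The size-Ramsey number of $\mathcal{G}$ is $$\widehat{R}_k(\mathcal{G}):=\min\{|E(\mathcal{H})| : \mathcal{H} \text{ is a } k\text{-graph with } \mathcal{H}\longrightarrow_k\mathcal{G}\}.$$ Let $1\le \ell<k$. A $k$-uniform hypergraph $\mathcal{T}$ is a relaxed $\ell$-tree if its edges admit an ordering $e_1,\ldots,e_m$ such that, for every $2\le j\le m$, $$\left|e_j\cap\bigcup_{i<j}e_i\right|\le \ell.$$ *)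

(* Defs.v *)
From HB Require Import structures.
From mathcomp Require Import all_boot all_order all_algebra.
From mathcomp Require Import boolp reals exp.

Set Implicit Arguments.
Unset Strict Implicit.
Unset Printing Implicit Defensive.

Record kgraph (k : nat) (V : finType) := KGraph {
  edges : {set {set V}};
  edges_uniform : forall e, e \in edges -> #|e| = k }.

(* The copy of [G] in [H] is the image of [G] under the injection [f].  The    *)
(* values of the coloring [c] on sets that are not edges of [H] play no role.  *)
Definition arrows (k : nat) (V W : finType) (H : kgraph k V) (G : kgraph k W) :=
  forall c : {set V} -> bool,
  exists f : W -> V, exists b : bool,
    [/\ injective f,
        [set f @: e | e : {set W} in edges G] \subset edges H
      & forall e, e \in [set f @: e | e : {set W} in edges G] -> c e = b].

(* The intersection condition on the j-th edge, with edges numbered from 0.    *)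
Definition relaxed_tree (l k : nat) (V : finType) (T : kgraph k V) :=
  exists s : seq {set V},
    [/\ uniq s, s =i edges T
      & forall j, 0 < j < size s ->
          #|nth set0 s j :&: \bigcup_(e <- take j s) e| <= l].

Definition arrowing_size (k : nat) (W : finType) (G : kgraph k W) (m : nat) :=
  exists (V : finType) (H : kgraph k V), arrows H G /\ #|edges H| = m.

(* Ramsey's theorem for two colors (off-diagonal), needed only to know that    *)
(* the minimum defining the size-Ramsey number is over a nonempty set.         *)
Lemma ramsey (k a0 a1 : nat) : exists N, forall (V : finType) (A : {set V})
    (c : {set V} -> bool), N <= #|A| ->
  exists (b : bool) (S : {set V}),
    [/\ S \subset A, (if b then a1 else a0) <= #|S|
      & forall e : {set V}, e \subset S -> #|e| = k -> c e = b].
Proof.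
elim: k a0 a1 => [|k IHk].
  move=> a0 a1; exists (a0 + a1) => V A c leA; exists (c set0), A; split=> //.
    by apply: leq_trans leA; case: (c _); rewrite ?leq_addl ?leq_addr.
  by move=> e _ /cards0_eq->.
have noe (V : finType) (e : {set V}) : e \subset set0 -> #|e| = k.+1 -> False.
  by rewrite subset0 => /eqP->; rewrite cards0.
elim=> [|a0 IH0] a1.
  exists 0 => V A c _; exists false, set0; split; rewrite ?sub0set //.
  by move=> e /noe h /h.
elim: a1 => [|a1 [N2 IH2]].
  exists 0 => V A c _; exists true, set0; split; rewrite ?sub0set //.
  by move=> e /noe h /h.
have [N1 IH1] := IH0 a1.+1; have [M IHM] := IHk N1 N2.
exists M.+1 => V A c ltA.
have [x xA] : exists x, x \in A by apply/card_gt0P; exact: leq_trans ltA.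
have leM : M <= #|A :\ x| by move: ltA; rewrite (cardsD1 x A) xA.
have [b [S [sSA leS homS]]] := IHM _ _ (fun e => c (x |: e)) leM.
have SA : S \subset A by apply: subset_trans sSA (subsetDl _ _).
have grow (S' : {set V}) : S' \subset S ->
    (forall e : {set V}, e \subset S' -> #|e| = k.+1 -> c e = b) ->
  [/\ x |: S' \subset A, #|x |: S'| = #|S'|.+1
    & forall e : {set V}, e \subset x |: S' -> #|e| = k.+1 -> c e = b].
  move=> sS'S homS'; split.
  - by rewrite subUset sub1set xA (subset_trans sS'S).
  - have xS' : x \notin S'.
      by apply/negP=> /(subsetP sS'S)/(subsetP sSA); rewrite !inE eqxx.
    by rewrite cardsU1 xS'.
  - move=> e sex ek; have [xe|xe] := boolP (x \in e); last first.
      apply: homS' ek; apply/subsetP=> y ye.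
      have := subsetP sex y ye; rewrite !inE => /orP[/eqP yx|//].
      by rewrite -yx ye in xe.
    rewrite -(setD1K xe); apply: homS; last first.
      by move: ek; rewrite (cardsD1 x e) xe => -[].
    by apply: subset_trans sS'S; rewrite subDset.
case: b leS homS grow => /= leS homS grow.
  have [b' [S' [sS'S leS' homS']]] := IH2 _ _ c leS.
  have S'A := subset_trans sS'S SA.
  case: b' leS' homS' => leS' homS'; last by exists false, S'.
  have [h1 h2 h3] := grow _ sS'S homS'.
  by exists true, (x |: S'); split; rewrite ?h2.
have [b' [S' [sS'S leS' homS']]] := IH1 _ _ c leS.
have S'A := subset_trans sS'S SA.
case: b' leS' homS' => leS' homS'; first by exists true, S'.
have [h1 h2 h3] := grow _ sS'S homS'.
by exists false, (x |: S'); split; rewrite ?h2.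
Qed.

Lemma arrowing_size_ex (k : nat) (W : finType) (G : kgraph k W) :
  exists m, `[< arrowing_size G m >].
Proof.
have [N ramN] := ramsey k #|W| #|W|.
pose E : {set {set 'I_N}} := [set e : {set 'I_N} | #|e| == k].
have Ek e : e \in E -> #|e| = k by rewrite inE => /eqP.
exists #|E|; apply/asboolP; exists 'I_N, (KGraph Ek); split=> // c.
have [|b [S [_ leS homS]]] := ramN _ [set: 'I_N] c; first by rewrite cardsT card_ord.
have {}leS : #|W| <= #|S| by case: b leS homS.
pose f (w : W) : 'I_N := enum_val (widen_ord leS (enum_rank w)).
have injf : injective f.
  by move=> u v /enum_val_inj [] /val_inj /enum_rank_inj.
have cardf (e : {set W}) : e \in edges G -> #|f @: e| = k.
  by move=> eG; rewrite card_imset // (edges_uniform eG).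
exists f, b; split=> //.
  by apply/subsetP=> _ /imsetP[e eG ->]; rewrite inE cardf.
move=> _ /imsetP[e eG ->]; apply: homS; last exact: cardf.
by apply/subsetP=> _ /imsetP[w _ ->]; exact: enum_valP.
Qed.

Definition size_ramsey (k : nat) (W : finType) (G : kgraph k W) : nat :=
  ex_minn (arrowing_size_ex G).

(* Main.v *)
Require Import Defs.
From HB Require Import structures.
From mathcomp Require Import all_boot all_order all_algebra.
From mathcomp Require Import boolp reals exp.
From mathcomp Require Import zify.

Set Implicit Arguments.
Unset Strict Implicit.
Unset Printing Implicit Defensive.

(** Fix a finite set [A] with a linear system of [l]-sets on it (two of them
    share at most one point), and enlarge each block by [d = k - l] vertices of
    its own.  In any order, an edge meets the union of the earlier ones inside
    its block, so the result is a relaxed [l]-tree.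

    It needs many edges in a host [H].  Take a uniformly random graph on the
    vertices of [H], and colour an edge of [H] by whether it contains an
    [l]-clique of that graph.  In a copy of the tree, a block which is a clique
    makes its edge true.  A block which is independent makes its edge false:
    two [l]-subsets of a [k]-set with [k <= 2 l - 2] share two vertices, so an
    [l]-clique of the edge and the independent block would share a pair.  Hence
    no copy is monochromatic once every injection of [A] into the set [U] of
    covered vertices of [H] sends some block to a clique and some block to an
    independent set ([expansion_not_arrows]).

    For one injection, the images of the blocks have pairwise disjoint sets of
    pairs, so these events are independent: no block is a clique with
    probability (1 - 2^-q)^r for [r] blocks and q = 'C(l, 2)
    ([card_avoid]).  The union bound over at most |U|^|A| injections succeeds
    ([clique_and_independent]) as long as log |U| is at most a small constant
    times r / |A|.

    The blocks are the lines y = a x + b over the integers modulo [l * M], with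
    0 <= x < l and slope 0 <= a < M: there are [l * M ^ 2] of them on
    [l ^ 2 * M] points, so [|edges H|] is at least exponential in [M], while the
    tree has O(M^2) vertices.  This yields the lower bound 2^(c sqrt n) of
    [relaxed_tree_size_ramsey], and sqrt n >= n^(1/l). *)

(** * Avoiding disjoint sets *)

(** Conditionally on avoiding the sets already treated, a uniformly random [X]
    contains the next one, [P i], with probability at least 2^-q: adding [P i]
    to [X] keeps the other sets, disjoint from it, uncovered, and only the
    trace of [X] on [P i], one of 2^q sets, is lost. *)
Lemma card_avoid (D I : finType) (q : nat) (P : I -> {set D}) (r : seq I) :
  (forall i, #|P i| = q) -> (forall i j, i != j -> [disjoint P i & P j]) ->
  uniq r ->
  #|[set X : {set D} | all (fun i => ~~ (P i \subset X)) r]| * 2 ^ (q * size r)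
    <= (2 ^ q - 1) ^ size r * 2 ^ #|D|.
Proof.
move=> cardP disP; elim: r => [|i r IH] /=.
  move=> _; rewrite muln0 expn0 muln1 mul1n -[#|D|]cardsT -card_powerset.
  by apply/subset_leq_card/subsetP => X _; rewrite powersetE subsetT.
move=> /andP[ir /IH {}IH].
set Y := [set X | all _ r] in IH; set Z := [set X | _ && _].
pose C := [set X : {set D} in Y | P i \subset X].
have YE : #|Y| = #|C| + #|Z|.
  rewrite -(cardsID [set X : {set D} | P i \subset X] Y); congr (_ + _).
    by apply: eq_card => X; rewrite !inE.
  by apply: eq_card => X; rewrite !inE.
have leY : #|Y| <= #|C| * 2 ^ q.
  rewrite -(cardP i) -card_powerset -cardsX.
  pose fill (X : {set D}) := (X :|: P i, X :&: P i).
  rewrite -(card_imset (f := fill)).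
    apply/subset_leq_card/subsetP => _ /imsetP[X + ->].
    rewrite !inE /= => /allP XY; rewrite subsetUr subsetIr !andbT.
    apply/allP => j jr; apply: contra (XY j jr) => PjXi.
    have ji : j != i by apply: contraNneq ir => <-.
    apply/subsetP => x xj; have := subsetP PjXi x xj.
    by rewrite inE (disjointFr (disP j i ji) xj) orbF.
  move=> X X' [eqU eqI]; apply/setP => x.
  by move/setP/(_ x): eqU; move/setP/(_ x): eqI; rewrite !inE; do 3 case: (x \in _).
have leZ : #|Z| * 2 ^ q <= (2 ^ q - 1) * #|Y|.
  by rewrite mulnBl mul1n YE; move: leY; rewrite YE; nia.
rewrite mulnS expnD mulnA expnS -[leqRHS]mulnA.
apply: leq_trans (leq_mul (leqnn _) IH).
by rewrite !mulnA leq_mul2r leZ orbT.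
Qed.

(** * Cliques and independent sets in a random graph *)

Definition pairs (V : finType) (S : {set V}) : {set {set V}} :=
  [set p : {set V} | (p \subset S) && (#|p| == 2)].

Lemma pairs_disjoint (V : finType) (S S' : {set V}) :
  #|S :&: S'| <= 1 -> [disjoint pairs S & pairs S'].
Proof.
move=> le1; apply/pred0P => p /=; apply/negP => /andP[].
rewrite !inE => /andP[pS /eqP p2] /andP[pS' _].
have /subset_leq_card : p \subset S :&: S' by rewrite subsetI pS.
by rewrite p2 leqNgt ltnS le1.
Qed.

(** The union bound for a random graph [X], a set of pairs.  The factor 2 covers
    the two requirements, which complementation of [X] exchanges. *)
Lemma clique_and_independent (V A I : finType) (U : {set V}) (l : nat)
    (B : I -> {set A}) :
  (forall i, #|B i| = l) -> (forall i j, i != j -> #|B i :&: B j| <= 1) ->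
  2 * #|U| ^ #|A| * (2 ^ 'C(l, 2) - 1) ^ #|I| < 2 ^ ('C(l, 2) * #|I|) ->
  exists X : {set {set V}}, forall g : A -> V,
    injective g -> (forall a, g a \in U) ->
    (exists i, pairs (g @: B i) \subset X) /\
    (exists i, pairs (g @: B i) \subset ~: X).
Proof.
move=> cardB linB few; set q := 'C(l, 2) in few.
pose avoid (g : {ffun A -> V}) :=
  [set X : {set {set V}} | all (fun i => ~~ (pairs (g @: B i) \subset X)) (enum I)].
pose maps := [set g : {ffun A -> V} in ffun_on (mem U) | injectiveb g].
pose bad := \bigcup_(g in maps) (avoid g :|: (@setC _) @: avoid g).
have card_avoid_map g : g \in maps ->
    #|avoid g| * 2 ^ (q * #|I|) <= (2 ^ q - 1) ^ #|I| * 2 ^ #|{set V}|.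
  rewrite inE => /andP[_ /injectiveP injg].
  rewrite [in #|I|]cardE; apply: card_avoid; rewrite ?enum_uniq //.
    by move=> i; rewrite cards_draws card_imset // cardB.
  move=> i j ij; apply: pairs_disjoint.
  by rewrite -imsetI; [rewrite card_imset // linB | move=> ? ? _ _ /injg].
have [X Xgood] : exists X, X \notin bad.
  apply/existsP; rewrite -negb_forall; apply/negP => /forallP allbad.
  have cardbad : 2 ^ #|{set V}| <= \sum_(g in maps) 2 * #|avoid g|.
    have -> : 2 ^ #|{set V}| = #|bad|.
      by rewrite -cardsT -card_powerset powersetT cardsT; apply: eq_card => X; rewrite allbad.
    rewrite /bad; elim/big_rec2: _ => [|g m S _ leS]; first by rewrite cards0.
    apply: leq_trans (leq_card_setU _ _) _; apply: leq_add leS.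
    apply: leq_trans (leq_card_setU _ _) _.
    by rewrite mul2n -addnn leq_add2l leq_imset_card.
  have : 2 ^ #|{set V}| * 2 ^ (q * #|I|)
      <= \sum_(g in maps) 2 * ((2 ^ q - 1) ^ #|I| * 2 ^ #|{set V}|).
    apply: leq_trans (leq_mul cardbad (leqnn _)) _.
    rewrite big_distrl /=; apply: leq_sum => g gm.
    by rewrite -mulnA leq_mul2l card_avoid_map ?orbT.
  rewrite sum_nat_const leqNgt => /negP; apply.
  have lemaps : #|maps| <= #|U| ^ #|A|.
    rewrite -card_ffun_on; apply: subset_leq_card.
    by apply/subsetP => g; rewrite inE => /andP[].
  apply: (@leq_ltn_trans (#|U| ^ #|A| * (2 * ((2 ^ q - 1) ^ #|I| * 2 ^ #|{set V}|)))).
    by rewrite leq_mul2r lemaps orbT.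
  rewrite !mulnA [X in _ < X]mulnC ltn_pmul2r ?expn_gt0 //.
  by rewrite [_ * 2]mulnC.
exists X => g injg gU; pose h := finfun g.
have hm : h \in maps.
  rewrite inE; apply/andP; split.
    by apply/ffun_onP => a; rewrite ffunE gU.
  by apply/injectiveP => a b; rewrite !ffunE => /injg.
have hE i : h @: B i = g @: B i by apply: eq_imset => a; rewrite ffunE.
have : X \notin avoid h :|: (@setC _) @: avoid h.
  by apply: contra Xgood => Xh; apply/bigcupP; exists h.
rewrite in_setU negb_or => /andP[Xh Xh'].
have found Y : Y \notin avoid h -> exists i, pairs (g @: B i) \subset Y.
  by rewrite inE => /allPn[i _]; rewrite negbK hE => ?; exists i.
split; first exact: found.
apply: found; apply: contra Xh' => Xh'.
by apply/imsetP; exists (~: X); rewrite ?setCK.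
Qed.

Lemma leq_expn2r m n e : m <= n -> m ^ e <= n ^ e.
Proof. by case: e => // e; rewrite leq_exp2r. Qed.

(** * Expansions of linear systems *)

Section Expansion.

Variables (A I W : finType) (l d : nat) (B : I -> {set A}).
(** [place] embeds the points and the private vertices into a type [W] which may
    be larger, so that the number of vertices can be prescribed. *)
Variable place : A + I * 'I_d -> W.
Hypotheses (card_block : forall i, #|B i| = l) (place_inj : injective place).

Definition core (i : I) : {set W} := [set place (inl a) | a in B i].
Definition private (i : I) : {set W} := [set place (inr (i, j)) | j : 'I_d].
Definition expanded_edge (i : I) : {set W} := core i :|: private i.

Lemma card_core i : #|core i| = l.
Proof. by rewrite card_imset ?card_block // => a b /place_inj[]. Qed.

Lemma expanded_edge_inl i a : (place (inl a) \in expanded_edge i) = (a \in B i).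
Proof.
rewrite inE; apply/orP/idP => [[|]|aB]; last by left; apply/imsetP; exists a.
  by case/imsetP => b bB /place_inj[->].
by case/imsetP => j _ /place_inj.
Qed.

Lemma expanded_edge_inr i i' j : (place (inr (i', j)) \in expanded_edge i) = (i' == i).
Proof.
rewrite inE; apply/orP/eqP => [[|]|->]; last by right; apply/imsetP; exists j.
  by case/imsetP => b bB /place_inj.
by case/imsetP => j' _ /place_inj[->].
Qed.

Lemma expanded_edges_uniform e :
  e \in [set expanded_edge i | i : I] -> #|e| = l + d.
Proof.
case/imsetP => i _ ->; rewrite cardsU card_core card_imset ?card_ord; last first.
  by move=> j j' /place_inj[].
rewrite (_ : _ :&: _ = set0) ?cards0 ?subn0 //; apply/setP => w; rewrite !inE.
by apply/andP => -[/imsetP[a _ ->] /imsetP[j _ /place_inj]].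
Qed.

Definition expansion : kgraph (l + d) W := KGraph expanded_edges_uniform.

(** Any order of the edges works, since a private vertex lies in no other edge;
    [0 < d] makes the edges distinct. *)
Lemma expansion_relaxed_tree : 0 < d -> relaxed_tree l expansion.
Proof.
move=> d_gt0; have edge_inj : injective expanded_edge.
  move=> i i' eq_e; have := expanded_edge_inr i i (Ordinal d_gt0).
  by rewrite eq_e expanded_edge_inr eqxx => /eqP.
exists [seq expanded_edge i | i <- enum I]; split.
- by rewrite map_inj_uniq ?enum_uniq.
- move=> e; apply/mapP/imsetP => -[i _ ->]; exists i => //.
  by rewrite mem_enum.
move=> j; rewrite size_map => /andP[_ ltj].
have [i0 _] : exists i0 : I, true by case: (enum I) ltj => // i0; exists i0.
rewrite (nth_map i0) // -map_take; set i := nth i0 _ j.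
rewrite -(card_core i); apply/subset_leq_card/subsetP => w.
rewrite in_setI => /andP[+ wU]; rewrite in_setU => /orP[//|/imsetP[m _ wE]].
move: wU; rewrite wE bigcup_seq => /bigcupP[_ /mapP[i' i'j ->]].
rewrite expanded_edge_inr => /eqP ii'; move: i'j; rewrite -ii'.
by move/index_ltn; rewrite /i index_uniq ?enum_uniq // ltnn.
Qed.

(** An edge is coloured by whether it contains an [l]-clique of the graph [X]
    given by [clique_and_independent].  As the blocks cover [A], a copy of the
    expansion sends [A] into the vertices covered by [H], and there are at most
    [(l + d) * #|edges H|] of these. *)
Lemma expansion_not_arrows (V : finType) (H : kgraph (l + d) V) :
  d + 2 <= l -> (forall i j, i != j -> #|B i :&: B j| <= 1) ->
  (forall a, exists i, a \in B i) ->
  2 * ((l + d) * #|edges H|) ^ #|A| * (2 ^ 'C(l, 2) - 1) ^ #|I|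
    < 2 ^ ('C(l, 2) * #|I|) ->
  ~ arrows H expansion.
Proof.
move=> led linB covB few; pose U := cover (edges H).
have cardU : #|U| <= (l + d) * #|edges H|.
  apply: leq_trans (leq_card_cover _) _.
  rewrite mulnC -sum_nat_const; apply: leq_sum => e eH.
  by rewrite (edges_uniform eH).
have [|X goodX] := clique_and_independent (U := U) card_block linB.
  apply: leq_ltn_trans few; rewrite leq_mul2r leq_mul2l.
  by rewrite leq_expn2r ?orbT.
pose c (e : {set V}) := [exists S : {set V},
  [&& S \subset e, #|S| == l & pairs S \subset X]].
move=> /(_ c)[f [b [injf fH mono]]].
have fedge i : f @: expanded_edge i \in [set f @: e | e : {set W} in edges expansion].
  by rewrite !imset_f.
pose g a := f (place (inl a)).
have gB i : g @: B i \subset f @: expanded_edge i.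
  apply/subsetP => _ /imsetP[a aB ->]; apply/imset_f.
  by rewrite expanded_edge_inl.
have injg : injective g by move=> a a' /injf/place_inj[].
have gU a : g a \in U.
  have [i aB] := covB a; apply/bigcupP; exists (f @: expanded_edge i).
    exact: subsetP fH _ (fedge i).
  by apply: (subsetP (gB i)); apply: imset_f.
have [[i clique] [j indep]] := goodX g injg gU.
have : c (f @: expanded_edge i).
  apply/existsP; exists (g @: B i).
  by rewrite gB card_imset // card_block eqxx.
rewrite mono // -(mono _ (fedge j)) => /existsP[S /and3P[Se /eqP Sl SX]].
(* Both sets have [l] elements in an edge of [l + d <= 2 * l - 2] vertices. *)
have : 1 < #|S :&: g @: B j|.
  have := subset_leq_card (_ : S :|: g @: B j \subset f @: expanded_edge j).
  rewrite subUset Se gB => /(_ isT).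
  rewrite cardsU Sl !card_imset // card_block.
  rewrite (expanded_edges_uniform (imset_f _ _)) //.
  have := subset_leq_card (subsetIl S (g @: B j)); lia.
case/card_gt1P => x [y] [xS yS xy].
have : [set x; y] \in X :&: ~: X; last by rewrite setICr inE.
move: xS yS; rewrite !in_setI => /andP[xS xB] /andP[yS yB].
apply/andP; split; [apply: (subsetP SX) | apply: (subsetP indep)];
  by rewrite inE cards2 xy eqxx andbT; apply/subsetP => z /set2P[]->.
Qed.

End Expansion.

(** * Lines over the integers modulo [l * M] *)

Section Lines.

Variables (l M : nat).
Hypothesis M_gt0 : 0 < M.
Let N := l * M.

Fact line_value_lt (ab : 'I_M * 'I_N) (i : 'I_l) : (ab.1 * i + ab.2) %% N < N.
Proof. by rewrite ltn_pmod //; apply: leq_ltn_trans (ltn_ord ab.2). Qed.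

Definition line (ab : 'I_M * 'I_N) : {set 'I_l * 'I_N} :=
  [set (i, Ordinal (line_value_lt ab i)) | i : 'I_l].

Lemma card_line ab : #|line ab| = l.
Proof. by rewrite card_imset ?card_ord // => i i' []. Qed.

Lemma line_cover p : exists ab, p \in line ab.
Proof.
exists (Ordinal M_gt0, p.2); apply/imsetP; exists p.1 => //.
by case: p => i y; apply/(congr1 (pair i))/val_inj; rewrite /= mul0n add0n modn_small.
Qed.

(** Two common points give [(a - a') * (i - i') = 0] modulo [l * M], where the
    product is less than [l * M] in absolute value.  It is therefore 0 as an
    integer, and the lines have the same slope. *)
Lemma line_inter ab ab' : ab != ab' -> #|line ab :&: line ab'| <= 1.
Proof.
move=> neq; rewrite leqNgt; apply/card_gt1P => -[p [p' []]].
rewrite !in_setI => /andP[/imsetP[i _ ->] /imsetP[i2 _ [<- e1]]].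
move=> /andP[/imsetP[i' _ ->] /imsetP[i2' _ [<- e2]]] neqp {i2 i2' p p'}.
have neqi : i != i' by apply: contraNneq neqp => ->.
case/negP: neq; apply/eqP; case: ab ab' e1 e2 {neqp} => [a b] [a' b'] /=.
move=> e1 e2; suff aa' : a = a'.
  rewrite -aa' in e1 *; congr (_, _); apply/val_inj => /=.
  by move/eqP: e1; rewrite eqn_modDl !modn_small // => /eqP.
apply/val_inj.
wlog lti : i i' e1 e2 neqi / i < i'.
  move=> IH; case: (ltngtP i i') => [|lt|/val_inj eqi]; first exact: IH.
    by apply: (IH i' i); rewrite // eq_sym.
  by rewrite eqi eqxx in neqi.
have : a * (i' - i) = a' * (i' - i) %[mod N].
  have shift (x y : nat) : x * i + y + x * (i' - i) = x * i' + y by nia.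
  apply/eqP; rewrite -(eqn_modDl (a * i + b)) shift e2 -shift.
  by rewrite -modnDml -e1 modnDml.
have small (x : 'I_M) : x * (i' - i) < N.
  rewrite /N mulnC; have := ltn_ord i'; have := ltn_ord x; nia.
rewrite !modn_small // => /eqP; rewrite eqn_pmul2r ?subn_gt0 //.
by move/eqP.
Qed.

End Lines.

(** * The size-Ramsey bound *)

(** Bernoulli's inequality for (1 + 1/x)^x. *)
Lemma bernoulli_expn x : 0 < x -> 2 * x ^ x <= (x + 1) ^ x.
Proof.
move=> x_gt0.
have bern m : x ^ m * (x + m) <= x * (x + 1) ^ m.
  elim: m => [|m IH]; first by rewrite !expn0; lia.
  rewrite !expnS; nia.
by have := bern x; rewrite -(leq_pmul2l x_gt0); nia.
Qed.

(** With [x = 2 ^ 'C(l, 2) - 1], lines of [M = 3 * l * x * s] slopes form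
    [l * M ^ 2 = x * t] blocks, where [t = 3 * s * l ^ 2 * M], on [l ^ 2 * M]
    points.  The random graph fails for one injection with probability at most
    (1 + 1/x)^-(x t) <= 2^-t, while a host with fewer than [2 ^ s] edges, each
    of [l + d <= s < 2 ^ s] vertices, covers fewer than [2 ^ (2 * s)] vertices,
    which leaves at most 2^(2t/3) injections. *)
Lemma relaxed_tree_size_ramsey (l d : nat) : 0 < d -> d + 2 <= l ->
  exists K, forall s n, l + d <= s -> K * s ^ 2 <= n ->
    exists T : kgraph (l + d) 'I_n, relaxed_tree l T /\ 2 ^ s <= size_ramsey T.
Proof.
move=> d_gt0 led; set q := 'C(l, 2).
have q_gt0 : 0 < q by rewrite bin_gt0; lia.
pose x := 2 ^ q - 1.
have x1E : x + 1 = 2 ^ q by rewrite subnK ?expn_gt0.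
have x_gt0 : 0 < x by rewrite subn_gt0 -{1}(expn0 2) ltn_exp2l.
pose m := 3 * l * x.
exists (l * (l * m) + m * (l * m) * d) => s n les leKn.
have s_gt0 : 0 < s by lia.
have M_gt0 : 0 < m * s by rewrite !muln_gt0 x_gt0; lia.
have cardW : #|{: 'I_l * 'I_(l * (m * s)) + 'I_(m * s) * 'I_(l * (m * s)) * 'I_d}| <= n.
  rewrite card_sum !card_prod !card_ord; apply: leq_trans leKn.
  have : s <= s ^ 2 by rewrite -mulnn leq_pmulr.
  by rewrite -mulnn; nia.
pose place w : 'I_n := widen_ord cardW (enum_rank w).
have place_inj : injective place by move=> u v [] /val_inj/enum_rank_inj.
exists (expansion (@card_line l (m * s)) place_inj); split.
  exact: expansion_relaxed_tree.
rewrite /size_ramsey; case: ex_minnP => E /asboolP[V [H [arr cardH]]] _.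
rewrite leqNgt; apply/negP => ltE; apply: expansion_not_arrows arr => //.
- exact: line_inter.
- exact: line_cover.
rewrite !card_prod !card_ord cardH -/q -/x.
set a := l * (l * (m * s)).
have -> : m * s * (l * (m * s)) = x * (3 * s * a) by rewrite /a /m; nia.
have a_gt1 : 1 < a by rewrite /a; nia.
have leE : ((l + d) * E) ^ a <= 2 ^ (2 * s * a).
  rewrite expnM; apply: leq_expn2r.
  rewrite mul2n -addnn expnD leq_mul ?(ltnW ltE) //.
  exact: leq_trans les (ltnW (ltn_expl _ _)).
set t := 3 * s * a.
have lt2 : 2 * ((l + d) * E) ^ a < 2 ^ t.
  apply: (@leq_ltn_trans (2 * 2 ^ (2 * s * a))); first by rewrite leq_mul2l leE orbT.
  by rewrite -expnS ltn_exp2l // /t; nia.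
apply: (@leq_trans ((2 * x ^ x) ^ t)).
  by rewrite [(2 * x ^ x) ^ t]expnMn -[(x ^ x) ^ t]expnM ltn_pmul2r // expn_gt0 x_gt0.
rewrite [2 ^ _]expnM -x1E [leqRHS]expnM.
exact/leq_expn2r/bernoulli_expn.
Qed.

Import Order.TTheory GRing.Theory Num.Theory.

Theorem theorem2 (R : realType) (l k : nat) (hl : 3 <= l)
    (hk : l + 1 <= k <= 2 * l - 2) :
  exists c : R, (0 < c)%R /\
    exists n0 : nat, forall n : nat, n0 <= n ->
      exists T : kgraph k 'I_n, relaxed_tree l T /\
        (2 `^ (c * n%:R `^ (l%:R^-1)) <= (size_ramsey T)%:R)%R.
Proof.
have [d kE] : exists d, k = l + d by exists (k - l); lia.
subst k; have [||K0 exT] := @relaxed_tree_size_ramsey l d; [lia | lia |].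
pose K := K0.+1.
exists ((2 * K)%:R^-1)%R; split; first by rewrite invr_gt0 ltr0n.
exists (K * (l + d) ^ 2) => n len.
have bnd s : K * s ^ 2 <= n -> s <= n.
  by rewrite /K -mulnn; nia.
have [s les max_s] := ex_maxnP (ex_intro (fun s => K * s ^ 2 <= n) _ len) bnd.
have lds := max_s _ len.
have [|T [Ttree leT]] := exT s n lds; first by rewrite /K in les; nia.
exists T; split=> //; have s_gt0 : 0 < s by lia.
(* [s] is maximal, and the exponent [l] is at least 2. *)
have le_n : n <= (2 * K * s) ^ l.
  have ltK : n < K * s.+1 ^ 2 by rewrite ltnNge; apply/negP => /max_s; rewrite ltnn.
  have : (2 * K * s) ^ 2 <= (2 * K * s) ^ l by rewrite leq_pexp2l //; nia.
  apply: leq_trans; apply: leq_trans (ltnW ltK) _.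
  have : s.+1 ^ 2 <= (2 * s) ^ 2 by rewrite leq_sqr; lia.
  rewrite (_ : 2 * K * s = K * (2 * s)); last by rewrite mulnCA mulnA.
  have leKK : K <= K ^ 2 by rewrite -mulnn leq_pmulr.
  by rewrite [(K * _) ^ 2]expnMn; apply: leq_mul leKK.
apply: (@le_trans _ _ (2 ^+ s)%R); last by rewrite -natrX ler_nat.
rewrite -powR_mulrn // ler_powR ?ler1n // ler_pdivrMl ?ltr0n // -natrM.
apply: (@le_trans _ _ (((2 * K * s) ^ l)%:R `^ l%:R^-1)%R).
  by rewrite ge0_ler_powR ?invr_ge0 ?ler0n ?nnegrE // ler_nat.
by rewrite natrX -powR_mulrn // -powRrM divff ?powRr1 // pnatr_eq0; lia.
Qed.
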